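(* Let $d\ge 1$, let $\mathbf{p}=(p_1,\dots,p_d)$ be a vector of nonzero real numbers, and let $\boldsymbol\pi=(\pi_2,\dots,\pi_d)$, where each $\pi_i$ is a permutation of $\{0,\dots,i-1\}$. Then the collection $\mathcal{T}_d(\mathbf{p},\boldsymbol\pi)$ constructed below is a simplicial tessellation of $\mathbb{R}^d$; every simplex $K\in\mathcal{T}_d(\mathbf{p},\boldsymbol\pi)$ satisfies $$\operatorname{meas}_d K=\prod_{i=1}^d |p_i|;$$ and every connected compact subset of the tessellation (i.e. every finite subcollection of its simplices whose union is connected) is a face-to-face mesh.
   Context: Construction. Inductively, for $m=1,\dots,d$, define a collection $\mathcal{T}_m$ of $m$-simplices in $\mathbb{R}^m$ with a coloring $c_m$ of their vertices by colors in $\{0,\dots,m\}$. (i) $m=1$: vertices $A_z=zp_1$, $z\in\mathbb{Z}$; simplices are the segments between $zp_1$ and $(z+1)p_1$; $c_1(A_z)=z \bmod 2$. (ii) Step $m-1\to m$ ($2\le m\le d$): put $c'=\pi_m\circ c_{m-1}$. For each $K\in\mathcal{T}_{m-1}$ label its vertices $A_0,\dots,A_{m-1}$ so that $c'(A_i)=i$. For $j\in\mathbb{Z}$ let $B^K_j=(A_{j\bmod m},\, jp_m)\in\mathbb{R}^m$, and for $z\in\mathbb{Z}$ let $L^{K,z}=\operatorname{conv}\{B^K_z,\dots,B^K_{z+m}\}$. Set $\mathcal{T}_m=\{L^{K,z}:K\in\mathcal{T}_{m-1},z\in\mathbb{Z}\}$. Its vertices are the points $(A,jp_m)$ with $A$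 a vertex of $\mathcal{T}_{m-1}$ and $j\equiv c'(A)\pmod m$, colored by $c_m((A,jp_m))=j\bmod(m+1)$. Then $\mathcal{T}_d(\mathbf{p},\boldsymbol\pi):=\mathcal{T}_d$. A simplicial tessellation of $\mathbb{R}^d$ is a collection of $d$-simplices covering $\mathbb{R}^d$ with pairwise disjoint interiors. A collection of simplices is a face-to-face mesh if any two of its simplices intersect either in the empty set or in a common face of both. $\operatorname{meas}_d$ is $d$-dimensional Lebesgue measure. *)

(* Defs.v *)
From HB Require Import structures.
From mathcomp Require Import all_boot all_order all_algebra all_fingroup.
From mathcomp Require Import all_classical all_reals all_analysis.

Set Implicit Arguments.
Unset Strict Implicit.
Unset Printing Implicit Defensive.

Import Order.TTheory GRing.Theory Num.Theory.
Import numFieldNormedType.Exports numFieldTopology.Exports.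
Local Open Scope classical_set_scope.
Local Open Scope ring_scope.

Section Tess.
Variable R : realType.

Definition ext n (a : 'rV[R]_n) (t : R) : 'rV[R]_n.+1 :=
  \row_(i < n.+1) (if unlift ord_max i is Some k then a 0 k else t).

(* d-dimensional Lebesgue measure, built as the iterated product measure
   (exactly the way MathComp-Analysis defines  m1 \x m2 , i.e.
   (m1 \x m2) A = \int[m1]_x m2 (section of A at x) ), with the Lebesgue
   measure on R as each factor. *)
Fixpoint meas (n : nat) : set 'rV[R]_n -> \bar R :=
  match n return set 'rV[R]_n -> \bar R with
  | 0 => fun S => (if `[< S (0 : 'rV[R]_0)%R >] then 1%E else 0%E)
  | n'.+1 => fun S =>
      (\int[@lebesgue_measure R]_(t in setT)
          meas [set a : 'rV[R]_n' | S (ext a t)])%E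
  end.

Definition hullI k n (V : 'I_k -> 'rV[R]_n) (I : {set 'I_k}) : set 'rV[R]_n :=
  [set x | exists w : 'I_k -> R,
     [/\ forall i, 0 <= w i, forall i, i \notin I -> w i = 0,
         \sum_i w i = 1 & x = \sum_i w i *: V i]].

Definition hull k n (V : 'I_k -> 'rV[R]_n) : set 'rV[R]_n := hullI V [set i : 'I_k | true]%SET.

Definition aff_indep k n (V : 'I_k -> 'rV[R]_n) : Prop :=
  forall w : 'I_k -> R, \sum_i w i = 0 -> \sum_i w i *: V i = 0 ->
    forall i, w i = 0.

Definition face k n (V : 'I_k -> 'rV[R]_n) (F : set 'rV[R]_n) : Prop :=
  exists I : {set 'I_k}, F = hullI V I.

Definition simplicial_tessellation n (T : set ('I_n.+1 -> 'rV[R]_n)) : Prop :=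
  [/\ forall V, T V -> aff_indep V,
      \bigcup_(V in T) hull V = setT
    & forall V W, T V -> T W -> hull V <> hull W ->
        @interior 'rV[R]_n (hull V) `&` @interior 'rV[R]_n (hull W) = set0].

Definition face_to_face k n (T : set ('I_k -> 'rV[R]_n)) : Prop :=
  forall V W, T V -> T W ->
    hull V `&` hull W = set0 \/
    exists F, [/\ face V F, face W F & hull V `&` hull W = F].

Variable p : nat -> R.                 (* p i = p_i, used for 1 <= i <= d *)
Variable pi : forall m : nat, 'S_m.    (* pi m = pi_m, used for 2 <= m <= d *)

(* The coloring c_{n+1} of vertices of T_{n+1} (points of R^(n+1)):
   a vertex (A, j p_{n+1}) gets color j mod (n+2); j is read off the last
   coordinate (j = last / p_{n+1}).  For n = 0 this is c_1(z p_1) = z mod 2. *)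
Definition color n (x : 'rV[R]_n.+1) : 'I_n.+2 :=
  inord (absz (Num.floor (x ord0 ord_max / p n.+1) %% (n.+2)%:Z)%Z).

Definition T1 : set ('I_2 -> 'rV[R]_1) :=
  [set V | exists z : int,
     V = fun k : 'I_2 => \row_(i < 1) ((z + (k : nat)%:Z)%:~R * p 1)].

(* Step m-1 -> m with m = n+2: from T_{n+1} to T_{n+2}.
   sigma labels the vertices of K: A_i = K (sigma i) with c'(A_i) = i,
   where c' = pi_m o c_{m-1}.  B_j = (A_{j mod m}, j p_m),
   L^{K,z} has vertices B_z, ..., B_{z+m} (vertex k |-> B_{z+k}). *)
Definition Tstep n (T : set ('I_n.+2 -> 'rV[R]_n.+1))
  : set ('I_n.+3 -> 'rV[R]_n.+2) :=
  [set L | exists K, exists z : int, exists sigma : 'S_n.+2,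
     [/\ T K,
         forall i : 'I_n.+2, pi n.+2 (color (K (sigma i))) = i
       & L = fun k : 'I_n.+3 =>
           let j := (z + (k : nat)%:Z)%Z in
           ext (K (sigma (inord (absz (j %% (n.+2)%:Z)%Z))))
               (j%:~R * p n.+2)]].

(* Tcon n = T_{n+1} *)
Fixpoint Tcon (n : nat) : set ('I_n.+2 -> 'rV[R]_n.+1) :=
  match n return set ('I_n.+2 -> 'rV[R]_n.+1) with
  | 0 => T1
  | n'.+1 => @Tstep n' (@Tcon n')
  end.

End Tess.

(* Main.v *)
(* Write a point of R^(n+1) as (x, t) with t its last coordinate. Over a simplex with
   vertices A_0, ..., A_n labelled by color, let x have barycentric coordinates
   L_0, ..., L_n, extended to integer indices mod n + 1. For the function
   f(z) = \sum_(z <= j <= z + n) L_j j one has f(z + 1) - f(z) = (n + 1) L_z, and (x, t)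
   belongs to the cell of index z exactly when f(z) <= t / p <= f(z + 1). Hence
   the cells over a simplex cover its prism, and since f only depends on the weights and
   colors of the vertices, a point common to two cells has the same barycentric weights
   on the same vertices in both. So cells meet in common faces, and disjointness of
   interiors follows by moving a common interior point towards a barycenter.
   The vertical section of a cell over x has length |p| (n + 1) L_z(x), and the integral of a barycentric coordinate over an
   n-simplex is 1 / (n + 1) of its volume because its superlevel sets are homothetic
   to the simplex; so Tonelli's theorem multiplies the volume by |p|. T_1 is obtained
   by the same step from the one-point mesh of R^0. *)
Require Import Defs.
From HB Require Import structures.
From mathcomp Require Import all_boot all_order all_algebra all_fingroup.
From mathcomp Require Import ring lra zify.
From mathcomp Require Import all_classical all_reals all_analysis.
From mathcomp Require Import measurable_realfun.

Set Implicit Arguments.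
Unset Strict Implicit.
Unset Printing Implicit Defensive.

Import Order.TTheory GRing.Theory Num.Theory.
Import numFieldNormedType.Exports numFieldTopology.Exports.
Local Open Scope classical_set_scope.
Local Open Scope ring_scope.

(** * Row vectors as a head and a last coordinate *)

Section Ext.
Variable R : realType.

Lemma ext_max n (a : 'rV[R]_n) t : ext a t 0 ord_max = t.
Proof. by rewrite mxE unlift_none. Qed.

Lemma ext_lift n (a : 'rV[R]_n) t k : ext a t 0 (lift ord_max k) = a 0 k.
Proof. by rewrite mxE liftK. Qed.

Definition rowproj n (x : 'rV[R]_n.+1) : 'rV[R]_n := \row_k x 0 (lift ord_max k).

Lemma rowproj_ext n (a : 'rV[R]_n) t : rowproj (ext a t) = a.
Proof. by apply/rowP => k; rewrite mxE ext_lift. Qed.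

Lemma ext_rowproj n (x : 'rV[R]_n.+1) : ext (rowproj x) (x 0 ord_max) = x.
Proof.
apply/rowP => i; case: (unliftP ord_max i) => [k|] ->.
  by rewrite ext_lift mxE.
by rewrite ext_max.
Qed.

Lemma ext0 n : ext (0 : 'rV[R]_n) 0 = 0.
Proof. by apply/rowP => i; rewrite !mxE; case: unlift => // j; rewrite mxE. Qed.

Lemma ext_inj n (a b : 'rV[R]_n) s t : ext a s = ext b t -> a = b /\ s = t.
Proof.
move=> e; split; first by rewrite -(rowproj_ext a s) e rowproj_ext.
by rewrite -(ext_max a s) e ext_max.
Qed.

Lemma ext_lin n (I : finType) (w : I -> R) (a : I -> 'rV[R]_n) (t : I -> R) :
  \sum_i w i *: ext (a i) (t i) = ext (\sum_i w i *: a i) (\sum_i w i * t i).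
Proof.
apply/rowP => i; rewrite summxE; case: (unliftP ord_max i) => [k|] ->.
  by rewrite ext_lift summxE; apply: eq_bigr => j _; rewrite [LHS]mxE ext_lift [RHS]mxE.
by rewrite ext_max; apply: eq_bigr => j _; rewrite mxE ext_max.
Qed.

End Ext.

(** * The iterated Lebesgue measure and its scaling *)

Section Measure.
Variable R : realType.

Definition coord_sets n : set (set 'rV[R]_n) :=
  \bigcup_i preimage_set_system setT (fun a : 'rV[R]_n => a 0 i) measurable.

Definition mrV n := g_sigma_algebraType (@coord_sets n).

Lemma measurable_coord n (i : 'I_n) :
  measurable_fun setT ((fun a => a 0 i) : mrV n -> R).
Proof.
move=> _ Y mY; apply: sub_sigma_algebra.
by exists i => //; exists Y.
Qed.

Lemma measurable_to_rV d (T : measurableType d) n (f : T -> mrV n) :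
  (forall i, measurable_fun setT (fun x => (f x : 'rV[R]_n) 0 i)) ->
  measurable_fun setT f.
Proof.
move=> mf; apply: (@measurability _ _ T (mrV n) setT f (@coord_sets n)) => //.
move=> _ [_ [i _ [Y mY <-]] <-].
by have := mf i measurableT Y mY; rewrite !setTI.
Qed.

Definition uext n (x : R * mrV n) : mrV n.+1 := ext x.2 x.1.

Lemma measurable_uext n : measurable_fun setT (@uext n).
Proof.
apply: measurable_to_rV => i; case: (unliftP ord_max i) => [k|] ->.
  under eq_fun do rewrite ext_lift.
  exact: (measurableT_comp (@measurable_coord n k) measurable_snd).
by under eq_fun do rewrite ext_max; exact: measurable_fst.
Qed.

Lemma measurable_rowproj n : measurable_fun setT (@rowproj R n : mrV n.+1 -> mrV n).
Proof.
apply: measurable_to_rV => i.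
by under eq_fun do rewrite mxE; exact: measurable_coord.
Qed.

Section prod_meas.
Variables (n : nat) (mu : {sigma_finite_measure set (mrV n) -> \bar R}).

Definition succ_meas : set (mrV n.+1) -> \bar R :=
  pushforward (@lebesgue_measure R \x mu)%E (@uext n).

HB.instance Definition _ := Measure.copy succ_meas
  (measure_function_pushforward__canonical__measure_function_Measure
     (@lebesgue_measure R \x mu)%E (@measurable_uext n)).

Let succ_meas_sigma_finite : sigma_finite setT succ_meas.
Proof.
have [F TF Ff] : sigma_finite setT (@lebesgue_measure R \x mu)%E.
  have /sigma_finiteP[F [TF ndF Foo]] := sigma_finiteT (@lebesgue_measure R).
  have /sigma_finiteP[G [TG ndG Goo]] := sigma_finiteT mu.
  exists (fun n => F n `*` G n).
    rewrite -setXTT TF TG predeqE => -[x y]; split.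
      move=> [/= [k _ Fkx] [l _ Gly]]; exists (maxn k l) => //; split.
      - by move: x Fkx; exact/subsetPset/ndF/leq_maxl.
      - by move: y Gly; exact/subsetPset/ndG/leq_maxr.
    by move=> [k _ []/= ? ?]; split; exists k.
  move=> k; have [? ?] := Foo k; have [? ?] := Goo k.
  split; first exact: measurableX.
  by rewrite product_measure1E// lte_mul_pinfty// ge0_fin_numE.
pose g (x : mrV n.+1) : R * mrV n := (x 0 ord_max, rowproj x).
have mg : measurable_fun setT g.
  apply: measurable_fun_pair; first exact: measurable_coord.
  exact: measurable_rowproj.
exists (fun i => g @^-1` F i).
  by rewrite -preimage_bigcup -TF preimage_setT.
move=> i; have [mF Foo] := Ff i; split.
  by rewrite -[X in measurable X]setTI; exact: mg.
rewrite /succ_meas /pushforward -comp_preimage.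
rewrite (_ : g \o @uext n = id); first exact: Foo.
by apply/funext => -[t a]; rewrite /g /uext /= rowproj_ext ext_max.
Qed.

HB.instance Definition _ := Measure_isSigmaFinite.Build _ _ _ succ_meas
  succ_meas_sigma_finite.

End prod_meas.

(** Tonelli's theorem needs a bundled sigma-finite measure, whereas [meas] is a bare recursive
    function. The induction starts from a Dirac mass on the one point of dimension zero. *)
Lemma meas_sigma_finite n : exists mu : {sigma_finite_measure set (mrV n) -> \bar R},
  (mu : set _ -> _) = @meas R n.
Proof.
elim: n => [|n [mu muE]].
  exists (@dirac _ (mrV 0) 0 R); apply/funext => S /=.
  rewrite /dirac indicE; case: asboolP => h.
    by rewrite mem_set.
  by rewrite memNset.
exists (succ_meas mu); apply/funext => S /=.
rewrite /succ_meas /pushforward /product_measure1 /= muE.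
apply: eq_integral => t _ /=; congr meas.
by apply/seteqP; split => a; rewrite /xsection /= inE.
Qed.

Lemma measurable_affine (c r : R) :
  measurable_fun setT (fun t : measurableTypeR R => (t - c) / r : measurableTypeR R).
Proof. by apply: measurable_funM => //; exact: measurable_funD. Qed.

(** The pushforward by the affine map, scaled by [r^-1], agrees with Lebesgue measure on half-open
    intervals, hence on all measurable sets by uniqueness. *)
Lemma lebesgue_measure_affine (c r : R) (A : set R) : 0 < r -> measurable A ->
  lebesgue_measure ((fun t : R => (t - c) / r) @^-1` A) = (r%:E * lebesgue_measure A)%E.
Proof.
move=> r0 mA.
have r1 : 0 <= r^-1 by rewrite invr_ge0 ltW.
pose nu : {measure set (measurableTypeR R) -> \bar R} :=
  mscale (NngNum r1)
  (measure_function_pushforward__canonical__measure_function_Measure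
     (@lebesgue_measure R) (measurable_affine c r)).
have nuE X : nu X =
  (r^-1%:E * lebesgue_measure ((fun t : R => (t - c) / r)%R @^-1` X))%E by [].
have key X : ocitv X -> lebesgue_measure X = nu X.
  move=> [[a b]] _ <-; rewrite nuE.
  rewrite [X in (_ * lebesgue_measure X)%E](_ : _ = `]a * r + c, b * r + c]%classic).
    rewrite !lebesgue_measure_itv /= !lte_fin ltrD2r ltr_pM2r//.
    case: ifPn => _; last by rewrite mule0.
    rewrite -!EFinD -EFinM; congr EFin; field; exact: lt0r_neq0.
  by apply/seteqP; split => t /=;
    rewrite !in_itv /= ltr_pdivlMr// ler_pdivrMr// ltrBrDr lerBlDr.
rewrite (lebesgue_measure_unique key mA : _ = nu A) nuE muleA -EFinM.
by rewrite divff ?mul1e// lt0r_neq0.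
Qed.

Lemma integral_affine (c r : R) (f : R -> \bar R) : 0 < r ->
  measurable_fun setT f -> (forall t, 0 <= f t)%E ->
  (\int[@lebesgue_measure R]_(t in setT) f ((t - c) / r)%R =
   r%:E * \int[@lebesgue_measure R]_(t in setT) f t)%E.
Proof.
move=> r0 mf f0; have r1 := ltW r0.
rewrite -(ge0_integral_mscale (@lebesgue_measure R) measurableT (NngNum r1))//.
rewrite -[LHS](@ge0_integral_pushforward _ _ _ _ R _ (measurable_affine c r)
  (@lebesgue_measure R) setT)//.
apply: (@eq_measure_integral _ _ _ _ (mscale (NngNum r1) (@lebesgue_measure R))
  (measure_function_pushforward__canonical__measure_function_Measure
     (@lebesgue_measure R) (measurable_affine c r))) => A mA _.
exact: lebesgue_measure_affine.
Qed.

(** Inverse of the map [x |-> c + r *: x], so that preimages under it are scaled and translated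
    copies. *)
Definition homothety n (c : 'rV[R]_n) (r : R) (x : 'rV[R]_n) := r^-1 *: (x - c).

Lemma measurable_meas_section n (S : set (mrV n.+1)) : measurable S ->
  measurable_fun setT (fun t => meas [set a : 'rV[R]_n | S (ext a t)]).
Proof.
move=> mS; have [mu <-] := meas_sigma_finite n.
have mS' : measurable (@uext n @^-1` S).
  by rewrite -[X in measurable X]setTI; exact: measurable_uext.
have := measurable_fun_xsection mu mS'; congr (measurable_fun _ _).
apply/funext => t /=; congr (mu _).
by apply/seteqP; split => a; rewrite /xsection /= inE.
Qed.

Lemma meas_ge0 n (S : set 'rV[R]_n) : (0 <= meas S)%E.
Proof. by have [mu <-] := meas_sigma_finite n. Qed.

Lemma measurable_section n (S : set (mrV n.+1)) t : measurable S ->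
  measurable ([set a : mrV n | S (ext a t)]).
Proof.
move=> mS.
have m : measurable_fun setT (fun a : mrV n => @uext n (t, a)).
  apply: measurableT_comp; first exact: measurable_uext.
  exact: pair1_measurable.
by have := m measurableT S mS; rewrite setTI.
Qed.

(** Induction on the dimension: the slice at height [t] is a homothetic copy of a slice of [S], and
    the change of variable in [t] supplies one more factor [r]. *)
Lemma meas_homothety n (c : 'rV[R]_n) (r : R) (S : set (mrV n)) : 0 < r ->
  measurable S -> meas (homothety c r @^-1` S) = ((r ^+ n)%:E * meas S)%E.
Proof.
move=> r0; elim: n => [|n IH] in c S * => mS.
  rewrite expr0 mul1e /=; congr (if _ then _ else _).
  by congr asbool; rewrite /preimage /= (_ : homothety c r 0 = 0)//; apply/rowP; case.
rewrite /=.
under eq_integral => t _.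
  rewrite (_ : [set a | _] = homothety (rowproj c) r @^-1`
    [set a : mrV n | S (ext a ((t - c 0 ord_max) / r))]); last first.
    rewrite /preimage; apply/funext => a /=; congr (S _).
    apply/rowP => i; case: (unliftP ord_max i) => [k|] ->.
      by rewrite ext_lift !mxE liftK.
    by rewrite ext_max !mxE unlift_none mulrC.
  rewrite IH; last exact: measurable_section.
  over.
rewrite ge0_integralZl//=; last 3 first.
- apply: (measurableT_comp (measurable_meas_section mS)).
  exact: measurable_affine.
- by move=> t _; exact: meas_ge0.
- by rewrite lee_fin exprn_ge0// ltW.
rewrite (@integral_affine (c 0 ord_max) r (fun t => meas [set a : 'rV[R]_n | S (ext a t)]))//.
- by rewrite muleA -EFinM exprSr.
- exact: measurable_meas_section.
- by move=> t; exact: meas_ge0.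
Qed.

End Measure.

(** * Residues of integer indices *)

Section Residue.
Variable n : nat.

(** Spelled like the labels in [Tstep] and the colors in [color], so that cells match by
    conversion. *)
Definition res (j : int) : 'I_n.+1 := inord (absz (j %% (n.+1)%:Z)%Z).

Lemma val_res j : (res j)%:Z = (j %% (n.+1)%:Z)%Z.
Proof.
have h0 : (0 <= (j %% (n.+1)%:Z)%Z) by rewrite modz_ge0.
have h1 : ((j %% (n.+1)%:Z)%Z < (n.+1)%:Z) by rewrite ltz_pmod.
by rewrite inordK; lia.
Qed.

Lemma res_addm j : res (j + (n.+1)%:Z) = res j.
Proof. by rewrite /res modzDr. Qed.

Lemma res_shift_inj z : injective (fun k : 'I_n.+1 => res (z + k%:Z)).
Proof.
move=> k l /(congr1 (fun i : 'I_n.+1 => i%:Z)); rewrite !val_res => /eqP.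
rewrite eqz_modDl !modz_small; first by move=> /eqP [] /val_inj.
  by have := ltn_ord l; lia.
by have := ltn_ord k; lia.
Qed.

Lemma sum_res (V : nmodType) (g : 'I_n.+1 -> V) z :
  \sum_i g i = \sum_(k < n.+1) g (res (z + k%:Z)).
Proof. by rewrite (reindex_inj (@res_shift_inj z)). Qed.

End Residue.

(** * Weights on a base simplex against weights on a cell above it *)

Section Weights.
Variables (R : realType) (n : nat).
Implicit Types (L : 'I_n.+1 -> R) (z : int) (s : R).

(** Height, in vertical steps, at which the cell of index [z] starts above the point with weights
    [L]. *)
Definition moment L z : R := \sum_(k < n.+1) L (res n (z + k%:Z)) * (z + k%:Z)%:~R.

(** Moving the window up by one trades the index [z] for [z + n.+1], which has the same residue,
    hence the same weight. *)
Lemma momentS L z : moment L (z + 1) = moment L z + n.+1%:R * L (res n z).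
Proof.
rewrite /moment big_ord_recr big_ord_recl /=.
rewrite [X in _ = _ + X + _](eq_bigr
  (fun i : 'I_n => L (res n (z + 1 + i%:Z)) * (z + 1 + i%:Z)%:~R)); last first.
  move=> i _; rewrite /bump /=.
  by rewrite (_ : z + 1 + i%:Z = z + (1 + i)%N%:Z)//; lia.
rewrite (_ : z + 1 + n%:Z = z + n.+1%:Z); last by lia.
rewrite res_addm addr0 rmorphD /= -pmulrn.
by set S := \sum_(i < n) _; ring.
Qed.

Lemma momentD L z d : moment L (z + d%:Z) =
  moment L z + n.+1%:R * \sum_(i < d) L (res n (z + i%:Z)).
Proof.
elim: d => [|d IH]; first by rewrite big_ord0 !addr0 mulr0 addr0.
rewrite (_ : z + d.+1%:Z = (z + d%:Z) + 1); last by lia.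
by rewrite momentS IH big_ord_recr /= mulrDr addrA.
Qed.

(* Barycentric weights, in the cell of index [z], of the point over base weights [L]
   whose height is [s] times the vertical step. The two end vertices lie over the same
   base vertex and share its weight so that the mean index is [s]. *)
Definition lift_weight L z s (k : 'I_n.+2) : R :=
  if (k : nat) == n.+1 then (s - moment L z) / n.+1%:R
  else if (k : nat) == 0%N then (moment L (z + 1) - s) / n.+1%:R
  else L (res n (z + k%:Z)).

(** On the lower boundary of the cell the last vertex loses its weight, and the first one takes all
    the weight of their common residue. *)
Lemma lift_weight_lo L z s (k : 'I_n.+2) : (k < n.+1)%N -> s = moment L z ->
  lift_weight L z s k = L (res n (z + k%:Z)).
Proof.
move=> kn ->; rewrite /lift_weight ltn_eqF//; case: eqP => // ->.
by rewrite momentS addr0 addrAC subrr add0r mulrC mulKf// pnatr_eq0.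
Qed.

Lemma lift_weight_hi L z s (k : 'I_n.+2) : (0 < k)%N -> s = moment L (z + 1) ->
  lift_weight L z s k = L (res n (z + k%:Z)).
Proof.
move=> k0 ->; rewrite /lift_weight; case: eqP => [->|_].
  by rewrite res_addm momentS addrAC subrr add0r mulrC mulKf// pnatr_eq0.
by rewrite eqn0Ngt k0.
Qed.

Lemma lift_weight_ends L z s :
  lift_weight L z s ord0 + lift_weight L z s ord_max = L (res n z).
Proof.
rewrite /lift_weight /= eqxx -mulrDl momentS.
rewrite (_ : _ + _ = n.+1%:R * L (res n z)); last by ring.
by rewrite mulrC mulKf// pnatr_eq0.
Qed.

(** The weight of the residue shared by the two ends is first put entirely on the index [z]; the
    last term corrects for the part sitting at [z + n.+1]. It vanishes for periodic [g], and for [g]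
    the identity it fixes the mean index. *)
Lemma sum_windowE (V : lmodType R) (w : 'I_n.+2 -> R) L z (g : int -> V) :
  w ord0 + w ord_max = L (res n z) ->
  (forall k : 'I_n.+2, (0 < k < n.+1)%N -> w k = L (res n (z + k%:Z))) ->
  \sum_k w k *: g (z + k%:Z) =
  \sum_(k < n.+1) L (res n (z + k%:Z)) *: g (z + k%:Z)
  + w ord_max *: (g (z + n.+1%:Z) - g z).
Proof.
move=> w0 wk; rewrite big_ord_recl big_ord_recr /= [in RHS]big_ord_recl /=.
have -> : lift ord0 (@ord_max n) = ord_max by apply/val_inj.
rewrite (_ : bump 0 n = n.+1)// !addr0 -w0 scalerDl scalerBr.
rewrite (eq_bigr
  (fun i : 'I_n => L (res n (z + (bump 0 i)%:Z)) *: g (z + (bump 0 i)%:Z))); last first.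
  by move=> i _; rewrite wk//= /bump /= ltnS add1n ltn_ord.
set S := \sum_(i < n) _; set a := _ *: _; set b := _ *: _; set c := _ *: _.
by rewrite -!addrA; congr (_ + _);
rewrite [RHS]addrCA; congr (_ + _); rewrite addrCA subrr addr0.
Qed.

Lemma sum_lift_weight (V : lmodType R) L z s (g : 'I_n.+1 -> V) :
  \sum_k lift_weight L z s k *: g (res n (z + k%:Z)) = \sum_i L i *: g i.
Proof.
rewrite (@sum_windowE _ _ L z (fun j => g (res n j))) ?lift_weight_ends//.
  by rewrite res_addm subrr scaler0 addr0 -(sum_res (fun i => L i *: g i)).
by move=> k /andP[k0 kn]; rewrite /lift_weight (ltn_eqF kn) gtn_eqF.
Qed.

Lemma sum1_lift_weight L z s : \sum_k lift_weight L z s k = \sum_i L i.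
Proof.
have := @sum_lift_weight R^o L z s (fun=> 1).
by under eq_bigr do rewrite [_ *: _]mulr1; under [in RHS]eq_bigr do rewrite [_ *: _]mulr1.
Qed.

Lemma moment_lift_weight L z s :
  \sum_k lift_weight L z s k * (z + k%:Z)%:~R = s.
Proof.
have := @sum_windowE R^o (lift_weight L z s) L z (fun j => j%:~R).
move=> -> //; first last.
- by move=> k /andP[k0 kn]; rewrite /lift_weight (ltn_eqF kn) gtn_eqF.
- exact: lift_weight_ends.
rewrite rmorphD /= addrAC subrr add0r [X in _ + X](_ : _ = s - moment L z); last first.
  by rewrite /lift_weight /= eqxx [_ *: _]mulrC mulrC divfK// pnatr_eq0.
by rewrite addrC -[RHS](subrK (moment L z)).
Qed.

(** Pushforward of the weights under the vertical projection of the cell onto its base. *)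
Definition base_weight z (w : 'I_n.+2 -> R) (i : 'I_n.+1) : R :=
  \sum_(k < n.+2 | res n (z + k%:Z) == i) w k.

Lemma sum_base_weight (V : lmodType R) z w (g : 'I_n.+1 -> V) :
  \sum_i base_weight z w i *: g i = \sum_k w k *: g (res n (z + k%:Z)).
Proof.
rewrite [RHS](partition_big (fun k : 'I_n.+2 => res n (z + k%:Z)) xpredT)//=.
apply: eq_bigr => i _; rewrite scaler_suml.
by apply: eq_bigr => k /eqP ->.
Qed.

Lemma sum1_base_weight z w : \sum_i base_weight z w i = \sum_k w k.
Proof.
have := @sum_base_weight R^o z w (fun=> 1).
by under eq_bigr do rewrite [_ *: _]mulr1; under [in RHS]eq_bigr do rewrite [_ *: _]mulr1.
Qed.

(** Among [n.+2] consecutive integers only the two ends share a residue, so an inner index is alone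
    in its class. *)
Lemma res_eq_window z (k l : 'I_n.+2) : (0 < k < n.+1)%N ->
  (res n (z + l%:Z) == res n (z + k%:Z)) = (l == k).
Proof.
move=> /andP[k0 kn]; apply/eqP/eqP => [|->//].
have [ln|ln] := ltnP l n.+1.
  move=> /(@res_shift_inj n z (Ordinal ln) (Ordinal kn)) [] lk; exact: val_inj.
have -> : (l : nat) = n.+1 by apply/eqP; rewrite eqn_leq ln -ltnS ltn_ord.
rewrite res_addm -[z in res n z = _]addr0.
move=> /(@res_shift_inj n z ord0 (Ordinal kn)) [] h; lia.
Qed.

Lemma base_weightE z w (k : 'I_n.+2) : (0 < k < n.+1)%N ->
  base_weight z w (res n (z + k%:Z)) = w k.
Proof.
by move=> hk; rewrite /base_weight (big_pred1 k)// => l /=; rewrite res_eq_window.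
Qed.

Lemma base_weight_ends z w :
  base_weight z w (res n z) = w ord0 + w ord_max.
Proof.
rewrite /base_weight (bigD1 ord0) ?addr0//= (bigD1 ord_max) ?res_addm ?eqxx//=.
rewrite big1 ?addr0// => k /andP[/andP[/eqP h k0]] km; exfalso.
have hk : (0 < k < n.+1)%N.
  rewrite lt0n; apply/andP; split; first by apply: contraNneq k0 => h0; apply/eqP/val_inj.
  rewrite ltn_neqAle -ltnS ltn_ord andbT.
  by apply: contraNneq km => h0; apply/eqP/val_inj.
have := res_eq_window z ord0 hk; rewrite addr0 h eqxx => /esym/eqP h0.
by move: k0; rewrite h0 eqxx.
Qed.

(** The inner weights are read off the projection, and the two ends are known from their sum and the
    sum of weighted indices. Being linear in [w], the identity also serves for affine
    independence. *)
Lemma lift_base_weight z w k : w k =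
  lift_weight (base_weight z w) z (\sum_k w k * (z + k%:Z)%:~R) k.
Proof.
have sE : \sum_k w k * (z + k%:Z)%:~R = moment (base_weight z w) z + n.+1%:R * w ord_max.
  rewrite (@sum_windowE R^o w (base_weight z w) z (fun j => j%:~R)) ?base_weight_ends//.
    by congr (_ + _); rewrite rmorphD /= addrAC subrr add0r [_ *: _]mulrC.
  by move=> l hl; rewrite base_weightE.
rewrite sE /lift_weight momentS base_weight_ends; case: eqP => [kn|/eqP kn].
  rewrite (_ : k = ord_max); last exact: val_inj.
  by rewrite addrAC subrr add0r mulrC mulKf// pnatr_eq0.
case: eqP => [k0|/eqP k0].
  rewrite (_ : k = ord0); last exact: val_inj.
  rewrite (_ : _ - _ = n.+1%:R * w ord0); last by ring.
  by rewrite mulrC mulKf// pnatr_eq0.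
rewrite base_weightE// lt0n k0 /= ltn_neqAle kn /= -ltnS; exact: ltn_ord.
Qed.

Lemma lift_weight_ge0 L z s : (forall i, 0 <= L i) ->
  moment L z <= s <= moment L (z + 1) -> forall k, 0 <= lift_weight L z s k.
Proof.
move=> L0 /andP[h1 h2] k; rewrite /lift_weight.
case: eqP => _; first by rewrite divr_ge0// subr_ge0.
by case: eqP => _ //; rewrite divr_ge0// subr_ge0.
Qed.

Lemma lift_weight_ge0_moment L z s : (forall k, 0 <= lift_weight L z s k) ->
  moment L z <= s <= moment L (z + 1).
Proof.
move=> h; have := h ord0; have := h ord_max; rewrite /lift_weight /= eqxx.
by rewrite !pmulr_lge0 ?invr_gt0// !subr_ge0 => -> ->.
Qed.

Lemma lift_weight_le L z s k : (forall i, 0 <= L i) ->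
  moment L z <= s <= moment L (z + 1) -> lift_weight L z s k <= L (res n (z + k%:Z)).
Proof.
move=> L0 h; have W0 := lift_weight_ge0 L0 h.
have e := lift_weight_ends L z s.
have [kn|kn] := eqVneq (k : nat) n.+1.
  rewrite kn res_addm -e (_ : k = ord_max); last exact: val_inj.
  by rewrite lerDr.
have [k0|k0] := eqVneq (k : nat) 0%N.
  rewrite k0 addr0 -e (_ : k = ord0); last exact: val_inj.
  by rewrite lerDl.
by rewrite /lift_weight (negbTE kn) (negbTE k0).
Qed.

(** For nonnegative weights [moment L] is nondecreasing, so a height squeezed this way forces
    equality and kills every increment in between. *)
Lemma moment_gap L z d s : (forall i, 0 <= L i) ->
  s <= moment L (z + 1) -> moment L (z + 1 + d%:Z) <= s ->
  [/\ s = moment L (z + 1), s = moment L (z + 1 + d%:Z) &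
    forall i, (i < d)%N -> L (res n (z + 1 + i%:Z)) = 0].
Proof.
move=> L0; rewrite momentD => h1 h2.
have S0 : 0 <= \sum_(i < d) L (res n (z + 1 + i%:Z)) by apply: sumr_ge0.
have m0 : 0 < n.+1%:R :> R by rewrite ltr0n.
have Sz : \sum_(i < d) L (res n (z + 1 + i%:Z)) = 0.
  apply/eqP; rewrite eq_le S0 andbT -(pmulr_rle0 _ m0).
  by rewrite -(lerD2l (moment L (z + 1))) addr0 (le_trans h2).
rewrite Sz mulr0 addr0 in h2 *.
have e : s = moment L (z + 1) by apply/eqP; rewrite eq_le h1 h2.
split=> // i id.
have /psumr_eq0P := Sz; move=> /(_ (fun _ _ => L0 _) (Ordinal id)); exact.
Qed.

(** If the windows differ, the height is the top of the lower cell and the bottom of the upper one.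
    Indices strictly between [z] and [z'] then carry no weight, so a weighted index lies in both
    windows. *)
Lemma lift_weight_window L z z' s (k : 'I_n.+2) : (forall i, 0 <= L i) ->
  moment L z <= s <= moment L (z + 1) -> moment L z' <= s <= moment L (z' + 1) ->
  0 < lift_weight L z s k ->
  exists k' : 'I_n.+2, z' + k'%:Z = z + k%:Z /\ lift_weight L z' s k' = lift_weight L z s k.
Proof.
move=> L0 hz hz' Wk; have /andP[h1 h2] := hz; have /andP[h1' h2'] := hz'.
have Lk : 0 < L (res n (z + k%:Z)) by apply: lt_le_trans (lift_weight_le k L0 hz).
have kn := ltn_ord k.
have [zz|zz|->] := ltgtP z z'; last by exists k.
- have [d dE] : exists d : nat, z' = z + 1 + d%:Z.
    by exists (absz (z' - z - 1)%R); lia.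
  rewrite dE in h1'.
  have [s1 s2 Lz] := moment_gap L0 h2 h1'; rewrite -dE in s2.
  have k0 : (0 < k)%N.
    rewrite lt0n; apply/eqP => k0; move: Wk.
    by rewrite /lift_weight k0 /= s1 subrr mul0r ltxx.
  have kd : (d <= k.-1)%N.
    rewrite leqNgt; apply/negP => /Lz.
    rewrite (_ : z + 1 + _ = z + k%:Z); last by lia.
    by move=> e; rewrite e ltxx in Lk.
  have hk : (k.-1 - d < n.+2)%N by lia.
  have e : z' + (k.-1 - d)%N%:Z = z + k%:Z by lia.
  exists (Ordinal hk); split; first exact: e.
  rewrite (lift_weight_hi k0 s1) lift_weight_lo//= ?e//; lia.
- have [d dE] : exists d : nat, z = z' + 1 + d%:Z.
    by exists (absz (z - z' - 1)%R); lia.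
  rewrite dE in h1.
  have [s1 s2 Lz] := moment_gap L0 h2' h1; rewrite -dE in s2.
  have km : (k < n.+1)%N.
    rewrite ltn_neqAle -ltnS kn andbT; apply/eqP => kE; move: Wk.
    by rewrite /lift_weight kE eqxx s2 subrr mul0r ltxx.
  have kd : (d.+1 + k <= n.+1)%N.
    rewrite leqNgt; apply/negP => kd.
    (* An index beyond the window of [z'] is one period above an index strictly between [z'] and
       [z], whose weight is zero. *)
    have /Lz : (d + k - n.+1 < d)%N by lia.
    rewrite -res_addm (_ : _ + _ = z + k%:Z); last by lia.
    by move=> e; rewrite e ltxx in Lk.
  have hk : (d.+1 + k < n.+2)%N by lia.
  have e : z' + (d.+1 + k)%N%:Z = z + k%:Z by lia.
  exists (Ordinal hk); split; first exact: e.
  by rewrite (lift_weight_lo km s2) lift_weight_hi//= e.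
Qed.

Lemma moment_bounds L z : (forall i, 0 <= L i) -> \sum_i L i = 1 ->
  z%:~R <= moment L z <= (z + n%:Z)%:~R.
Proof.
move=> L0 L1; rewrite (sum_res L z) in L1.
have e x : x = \sum_(k < n.+1) L (res n (z + k%:Z)) * x by rewrite -mulr_suml L1 mul1r.
rewrite [z%:~R]e [(z + _)%:~R]e; apply/andP; split.
  by apply: ler_sum => k _; apply: ler_wpM2l => //; rewrite ler_int; lia.
apply: ler_sum => k _; apply: ler_wpM2l => //; rewrite ler_int.
by have := ltn_ord k; lia.
Qed.

(** Discrete intermediate value argument: take the least index at which [moment L] reaches [s]. *)
Lemma ex_moment_window L s : (forall i, 0 <= L i) -> \sum_i L i = 1 ->
  exists z, moment L z <= s <= moment L (z + 1).
Proof.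
move=> L0 L1; pose z0 := Num.floor s - n%:Z.
have h0 : moment L z0 <= s.
  have /andP[_ h] := moment_bounds z0 L0 L1; apply: (le_trans h).
  by rewrite /z0 subrK; exact: floor_le.
have h1 : s <= moment L (z0 + n.+1%:Z).
  have /andP[h _] := moment_bounds (z0 + n.+1%:Z) L0 L1; apply: le_trans h.
  rewrite (_ : z0 + _ = Num.floor s + 1); last by rewrite /z0; lia.
  exact/ltW/floorD1_gt.
have : exists i : nat, s <= moment L (z0 + i%:Z) by exists n.+1.
move=> /ex_minnP[[|i] hi min].
  exists z0; rewrite h0 /= momentS.
  by rewrite (le_trans hi)// addr0 lerDl mulr_ge0.
exists (z0 + i%:Z); apply/andP; split.
  rewrite leNgt; apply/negP => h; have := min i (ltW h); lia.
by rewrite (_ : _ + 1 = z0 + i.+1%:Z)//; lia.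
Qed.

End Weights.

Section Hull.
Variables (R : realType) (k n : nat).
Implicit Types V W : 'I_k -> 'rV[R]_n.

Definition weights (I : finType) (w : I -> R) : Prop :=
  (forall i, 0 <= w i) /\ \sum_i w i = 1.

Lemma hullP V x : hull V x <-> exists2 w, weights w & x = \sum_i w i *: V i.
Proof.
split=> [[w [w0 _ w1 ->]]|[w [w0 w1] ->]]; first by exists w.
by exists w; split=> // i; rewrite inE.
Qed.

Lemma hull_perm V (s : 'S_k) : hull (V \o s) = hull V.
Proof.
apply/seteqP; split=> x /hullP[w [w0 w1] ->]; apply/hullP.
  exists (w \o (s^-1)%g).
    split=> [i|]; first exact: w0.
    by rewrite (reindex_inj (@perm_inj _ s)) /=; under eq_bigr do rewrite permK.
  by rewrite [RHS](reindex_inj (@perm_inj _ s)) /=; under [RHS]eq_bigr do rewrite permK.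
exists (w \o s).
  split=> [i|]; first exact: w0.
  by rewrite -(reindex_inj (@perm_inj _ s) (P := xpredT) (F := w)).
by rewrite (reindex_inj (@perm_inj _ s)).
Qed.

Lemma aff_indep_perm V (s : 'S_k) : aff_indep V -> aff_indep (V \o s).
Proof.
move=> aV w w1 wV i.
have := aV (w \o (s^-1)%g) _ _ (s i); rewrite /= permK; apply.
  by rewrite (reindex_inj (@perm_inj _ s)) /=; under eq_bigr do rewrite permK.
by rewrite (reindex_inj (@perm_inj _ s)) /=; under eq_bigr do rewrite permK.
Qed.

(* The barycentric weights of a common point of the two simplices agree. *)
Definition compatible V W : Prop := forall v w, weights v -> weights w ->
  \sum_i v i *: V i = \sum_i w i *: W i ->
  forall i, 0 < v i -> exists2 j, W j = V i & w j = v i.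

Lemma compatible_perm V W (s t : 'S_k) : compatible V W ->
  compatible (V \o s) (W \o t).
Proof.
move=> VW v w [v0 v1] [w0 w1] e i vi.
have [j WV wv] : exists2 j, W j = V (s i) & (w \o (t^-1)%g) j = (v \o (s^-1)%g) (s i).
  apply: VW.
  - split=> [j|]; first exact: v0.
    by rewrite (reindex_inj (@perm_inj _ s)) /=; under eq_bigr do rewrite permK.
  - split=> [j|]; first exact: w0.
    by rewrite (reindex_inj (@perm_inj _ t)) /=; under eq_bigr do rewrite permK.
  - rewrite (reindex_inj (@perm_inj _ s)) [RHS](reindex_inj (@perm_inj _ t)) /=.
    by under eq_bigr do rewrite permK; under [RHS]eq_bigr do rewrite permK.
  - by rewrite /= permK.
by exists ((t^-1)%g j) => /=; [rewrite permKV | rewrite /= permK in wv].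
Qed.

Lemma hullI_setI V W : compatible V W ->
  hull V `&` hull W = hullI V [set i | [exists j, W j == V i]]%SET.
Proof.
move=> VW; apply/seteqP; split=> [x [/hullP[v hv xv] /hullP[w hw xw]]|x [v [v0 vI v1 xv]]].
  exists v; split=> //; [exact: hv.1| |exact: hv.2] => i; rewrite inE => iI.
  apply/eqP; rewrite eq_le hv.1 andbT leNgt; apply: contra iI => vi.
  have [j WV _] := VW v w hv hw (etrans (esym xv) xw) i vi.
  by apply/existsP; exists j; rewrite WV.
have hx : hull V x by apply/hullP; exists v.
split=> //.
pose h i : 'I_k := odflt i [pick j | W j == V i].
have hE i : v i != 0 -> W (h i) = V i.
  move=> vi; rewrite /h; case: pickP => [j /eqP //|no].
  have : i \in [set i | [exists j, W j == V i]]%SET.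
    by apply: contraNT vi => /vI ->.
  by rewrite inE => /existsP[j]; rewrite no.
apply/hullP; exists (fun j => \sum_(i | h i == j) v i).
  split=> [j|]; first exact: sumr_ge0.
  by rewrite -v1 [RHS](partition_big h xpredT).
rewrite xv [LHS](partition_big h xpredT)//=; apply: eq_bigr => j _.
rewrite scaler_suml; apply: eq_bigr => i /eqP <-.
by have [->|vi] := eqVneq (v i) 0; rewrite ?scale0r// hE.
Qed.

Lemma compatible_face V W : compatible V W -> compatible W V ->
  exists F, [/\ face V F, face W F & hull V `&` hull W = F].
Proof.
move=> VW WV; exists (hull V `&` hull W); split=> //.
  by rewrite hullI_setI//; eexists.
by rewrite setIC hullI_setI//; eexists.
Qed.

Lemma vertices_sub_hull V W : (forall i, exists j, W j = V i) ->
  hull V `<=` hull W.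
Proof.
move=> VW x /hullP[v [v0 v1] ->].
have [h hE] := choice VW.
apply/hullP; exists (fun j => \sum_(i | h i == j) v i).
  split=> [j|]; first exact: sumr_ge0.
  by rewrite -v1 [RHS](partition_big h xpredT).
rewrite [LHS](partition_big h xpredT)//=; apply: eq_bigr => j _.
by rewrite scaler_suml; apply: eq_bigr => i /eqP <-; rewrite hE.
Qed.

Lemma interior_sub_hull V W x : (0 < k)%N -> compatible V W ->
  @interior 'rV[R]_n (hull V) x -> @interior 'rV[R]_n (hull W) x ->
  hull V `<=` hull W.
Proof.
move=> k0 VW Vx Wx; apply: vertices_sub_hull => i.
have /hullP[v [v0 v1] xv] : hull V x by exact: (@interior_subset 'rV[R]_n).
pose b : 'rV[R]_n := \sum_i k%:R^-1 *: V i.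
have [e e0 he] : exists2 e : R, 0 < e & @ball R 'rV[R]_n x e `<=` hull W.
  by move: Wx => /nbhs_ballP[e /= e0 he]; exists e.
pose M := \sum_j `|(b - x) 0 j|.
have M0 : 0 <= M by apply: sumr_ge0.
pose d := Num.min 1 (e / (M + 1) / 2).
have d0 : 0 < d by rewrite /d lt_min ltr01 /= !divr_gt0// ltr_wpDl.
have d1 : d <= 1 by rewrite /d ge_min lexx.
have hd : d * M < e.
  have : d <= e / (M + 1) / 2 by rewrite /d ge_min lexx orbT.
  rewrite -mulrA -invfM ler_pdivlMr ?mulr_gt0// ?ltr_wpDl// => h.
  nra.
have /he/hullP[w hw xw] : @ball R 'rV[R]_n x e (x + d *: (b - x)).
  split=> // a j; rewrite /ball /= !mxE opprD addrA subrr sub0r normrN normrM gtr0_norm//.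
  apply: le_lt_trans hd; rewrite ler_pM2l// (ord1 a).
  rewrite /M (bigD1 j)//= !mxE lerDl; exact: sumr_ge0.
have k1 : k%:R * k%:R^-1 = 1 :> R by rewrite mulfV// pnatr_eq0 -lt0n.
have [] := VW (fun i => (1 - d) * v i + d * k%:R^-1) w _ hw _ i.
- split=> [j|].
    by rewrite addr_ge0// mulr_ge0 ?subr_ge0 ?invr_ge0 ?ler0n// ltW.
  rewrite big_split /= -mulr_sumr v1 mulr1 sumr_const card_ord -mulrnAr.
  by rewrite -[_ *+ k]mulr_natl k1 mulr1 subrK.
- rewrite -xw; under eq_bigr do rewrite scalerDl -!scalerA.
  rewrite big_split /= -!scaler_sumr -xv -/b.
  by rewrite scalerBr scalerBl scale1r -addrA /b -scaler_sumr; congr (_ + _); rewrite addrC.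
- by rewrite ltr_wpDl// ?mulr_ge0 ?subr_ge0// mulr_gt0// invr_gt0 ltr0n.
- by move=> j WV _; exists j.
Qed.

End Hull.

Section Step.
Variables (R : realType) (n : nat).
Implicit Types (A : 'I_n.+1 -> 'rV[R]_n) (z : int) (q : R).

Definition prism_cell A z q : 'I_n.+2 -> 'rV[R]_n.+1 :=
  fun k => ext (A (res n (z + (k : nat)%:Z))) ((z + (k : nat)%:Z)%:~R * q).

Lemma sum_prism_cell A z q (w : 'I_n.+2 -> R) :
  \sum_k w k *: prism_cell A z q k =
  ext (\sum_i base_weight z w i *: A i)
      ((\sum_(k < n.+2) w k * (z + (k : nat)%:Z)%:~R) * q).
Proof.
rewrite ext_lin sum_base_weight mulr_suml.
by congr ext; apply: eq_bigr => k _; rewrite mulrA.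
Qed.

Lemma weights_base z (w : 'I_n.+2 -> R) : weights w -> weights (base_weight z w).
Proof.
move=> [w0 w1]; split; last by rewrite sum1_base_weight.
by move=> i; apply: sumr_ge0.
Qed.

Lemma moment_base z (w : 'I_n.+2 -> R) : weights w ->
  moment (base_weight z w) z <= \sum_(k < n.+2) w k * (z + (k : nat)%:Z)%:~R
    <= moment (base_weight z w) (z + 1).
Proof.
move=> [w0 w1]; apply: lift_weight_ge0_moment => k.
by rewrite -lift_base_weight.
Qed.

Lemma hull_prism_cellP A z q x t : q != 0 ->
  hull (prism_cell A z q) (ext x t) <->
  exists L, [/\ weights L, x = \sum_i L i *: A i &
     moment L z <= t / q <= moment L (z + 1)].
Proof.
move=> q0; split.
  move=> /hullP[w ww]; rewrite sum_prism_cell => /ext_inj[-> ->].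
  exists (base_weight z w); split=> //; first exact: weights_base.
  by rewrite mulfK//; exact: moment_base.
move=> [L [[L0 L1] -> Lt]]; apply/hullP.
exists (lift_weight L z (t / q)).
  by split; [exact: lift_weight_ge0|rewrite sum1_lift_weight].
rewrite ext_lin (sum_lift_weight L z (t / q) A); congr ext.
under eq_bigr do rewrite mulrA.
by rewrite -mulr_suml moment_lift_weight divfK.
Qed.

Lemma aff_indep_prism_cell A z q : q != 0 -> aff_indep A ->
  aff_indep (prism_cell A z q).
Proof.
move=> q0 aA w w0; rewrite sum_prism_cell => e k.
have [eA es] : \sum_i base_weight z w i *: A i = 0 /\
    \sum_(k < n.+2) w k * (z + (k : nat)%:Z)%:~R = 0.
  move: e; rewrite -ext0 => /ext_inj[-> /eqP]; rewrite mulf_eq0 (negbTE q0) orbF.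
  by move/eqP.
have L0 : forall i, base_weight z w i = 0.
  by apply: aA => //; rewrite sum1_base_weight.
have m0 z' : moment (base_weight z w) z' = 0.
  by rewrite /moment big1// => i _; rewrite L0 mul0r.
rewrite (lift_base_weight z w k) es /lift_weight !m0 L0 subr0 mul0r.
by case: ifP => //; case: ifP.
Qed.

Lemma compatible_prism_cell (c : 'rV[R]_n -> 'I_n.+1) A B z z' q : q != 0 ->
  compatible A B -> compatible B A ->
  (forall i, c (A i) = i) -> (forall i, c (B i) = i) ->
  compatible (prism_cell A z q) (prism_cell B z' q).
Proof.
move=> q0 AB BA cA cB v w wv ww; rewrite !sum_prism_cell => /ext_inj[eAB].
move=> /(mulIf q0) es k vk.
have LA := weights_base z wv; have LB := weights_base z' ww.
have AE i : 0 < base_weight z v i -> B i = A i /\ base_weight z' w i = base_weight z v i.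
  move=> vi; have [j jA jw] := AB _ _ LA LB eAB i vi.
  have ji : j = i by rewrite -(cB j) jA cA.
  by rewrite ji in jA jw.
have BE i : 0 < base_weight z' w i -> base_weight z' w i = base_weight z v i.
  move=> wi; have [j jA jw] := BA _ _ LB LA (esym eAB) i wi.
  have ji : j = i by rewrite -(cA j) jA cB.
  by rewrite ji in jw.
have LE : base_weight z v = base_weight z' w.
  apply/funext => i; have := LA.1 i; have := LB.1 i.
  rewrite !le_eqVlt => /orP[/eqP wi|/BE //] /orP[/eqP vi|/AE[//]].
  by rewrite -wi -vi.
have hz := moment_base z wv; have hz' := moment_base z' ww.
rewrite -LE -es in hz'.
have vkE := lift_base_weight z v k.
have [k' [k'E wE]] : exists k' : 'I_n.+2, z' + k'%:Z = z + k%:Z /\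
    lift_weight (base_weight z v) z' (\sum_(k < n.+2) v k * (z + (k : nat)%:Z)%:~R) k' =
    lift_weight (base_weight z v) z (\sum_(k < n.+2) v k * (z + (k : nat)%:Z)%:~R) k.
  by apply: lift_weight_window => //; [exact: LA.1|rewrite -vkE].
exists k'.
  rewrite /prism_cell k'E; congr ext.
  have [] := AE (res n (z + k%:Z)) => //.
  apply: (lt_le_trans vk); rewrite vkE; apply: lift_weight_le => //; exact: LA.1.
by rewrite (lift_base_weight z' w k') -LE -es wE -vkE.
Qed.

Lemma prism_cell_cover A q x t : q != 0 -> hull A x ->
  exists z, hull (prism_cell A z q) (ext x t).
Proof.
move=> q0 /hullP[L LL xL].
have [z hz] := ex_moment_window (t / q) LL.1 LL.2.
by exists z; apply/hull_prism_cellP => //; exists L.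
Qed.

End Step.

Section Barycentric.
Variables (R : realType) (n : nat) (A : 'I_n.+1 -> 'rV[R]_n).
Hypothesis aA : aff_indep A.

Let M : 'M[R]_n.+1 := \matrix_i ext (A i) 1.

Lemma mul_bary_mx (v : 'rV[R]_n.+1) :
  v *m M = ext (\sum_i v 0 i *: A i) (\sum_i v 0 i).
Proof.
rewrite mulmx_sum_row; under eq_bigr do rewrite rowK.
by rewrite (ext_lin (fun i => v 0 i)); congr ext; apply: eq_bigr => i _; rewrite mulr1.
Qed.

Lemma bary_mx_unit : M \in unitmx.
Proof.
rewrite -row_free_unit -kermx_eq0; apply/eqP/row_matrixP => i.
rewrite row0; set v := row i _.
have vM : v *m M = 0 by apply: sub_kermxP; exact: row_sub.
have /ext_inj[h1 h2] : ext (\sum_i v 0 i *: A i) (\sum_i v 0 i) = ext 0 0.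
  by rewrite -mul_bary_mx vM ext0.
by apply/rowP => j; rewrite [RHS]mxE; exact: (aA h2 h1).
Qed.

Definition bary (x : 'rV[R]_n) (i : 'I_n.+1) : R := (ext x 1 *m invmx M) 0 i.

Lemma baryP x : \sum_i bary x i = 1 /\ \sum_i bary x i *: A i = x.
Proof.
have : ext x 1 *m invmx M *m M = ext x 1 by rewrite mulmxKV// bary_mx_unit.
by rewrite mul_bary_mx => /ext_inj[].
Qed.

Lemma bary_unique x (w : 'I_n.+1 -> R) : \sum_i w i = 1 ->
  x = \sum_i w i *: A i -> w = bary x.
Proof.
move=> w1 ->; apply/funext => i; rewrite /bary.
have -> : ext (\sum_i w i *: A i) 1 = (\row_i w i) *m M.
  rewrite mul_bary_mx -w1; congr ext; apply: eq_bigr => j _; by rewrite mxE.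
by rewrite mulmxK ?bary_mx_unit// mxE.
Qed.

Lemma hull_baryP x : hull A x <-> forall i, 0 <= bary x i.
Proof.
have [b1 bA] := baryP x; split=> [/hullP[w [w0 w1] xw]|b0].
  by rewrite -(bary_unique w1 xw).
by apply/hullP; exists (bary x).
Qed.

Lemma measurable_bary i : measurable_fun setT ((bary ^~ i) : mrV R n -> R).
Proof.
rewrite (_ : bary ^~ i = fun x => \sum_j ext x 1 0 j * invmx M j i); last first.
  by apply/funext => x; rewrite /bary mxE.
apply: measurable_sum => j; apply: measurable_funM => //.
case: (unliftP ord_max j) => [l|] ->.
  by under eq_fun do rewrite ext_lift; exact: measurable_coord.
by under eq_fun do rewrite ext_max; exact: measurable_cst.
Qed.

Lemma measurable_hull : measurable (hull A : set (mrV R n)).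
Proof.
rewrite (_ : hull A = \bigcap_(i in [set: 'I_n.+1]) (bary ^~ i @^-1` `[0, +oo[)); last first.
  apply/seteqP; split=> x.
    by move=> /hull_baryP h i _ /=; rewrite in_itv /= andbT.
  by move=> h; apply/hull_baryP => i; have := h i I; rewrite /= in_itv /= andbT.
apply: fin_bigcap_measurable => // i _.
by rewrite -[X in measurable X]setTI; exact: measurable_bary.
Qed.

Lemma bary_ge_homothety i s : 0 <= s < 1 ->
  [set x | hull A x /\ s <= bary x i] = homothety (s *: A i) (1 - s) @^-1` hull A.
Proof.
move=> /andP[s0 s1].
have r0 : 0 < 1 - s by rewrite subr_gt0.
have sumD (f : 'I_n.+1 -> R) : \sum_j (j == i)%:R * f j = f i.
  by rewrite (bigD1 i)//= eqxx mul1r big1 ?addr0// => j /negbTE ->; rewrite mul0r.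
have sumA : \sum_j (j == i)%:R *: A j = A i.
  by rewrite (bigD1 i)//= eqxx scale1r big1 ?addr0// => j /negbTE ->; rewrite scale0r.
apply/seteqP; split=> x /=.
  move=> [/hull_baryP b0 bs]; have [b1 bA] := baryP x.
  apply/hullP; exists (fun j => (1 - s)^-1 * (bary x j - s * (j == i)%:R)).
    split=> [j|].
      apply: mulr_ge0; first by rewrite invr_ge0 ltW.
      by rewrite subr_ge0; case: eqP => [->|_]; rewrite ?mulr1 ?mulr0.
    rewrite -mulr_sumr sumrB b1 -mulr_sumr.
    have := sumD (fun=> 1); under eq_bigr do rewrite mulr1; move=> ->.
    by rewrite mulr1 mulVf// lt0r_neq0.
  under eq_bigr do rewrite -scalerA scalerBl -scalerA.
  by rewrite -scaler_sumr sumrB -scaler_sumr bA sumA.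
move=> /hullP[w [w0 w1] xw].
have xE : x = \sum_j (s * (j == i)%:R + (1 - s) * w j) *: A j.
  under eq_bigr do rewrite scalerDl -!scalerA.
  rewrite big_split /= -!scaler_sumr sumA -xw /homothety scalerA mulfV ?lt0r_neq0//.
  by rewrite scale1r addrC subrK.
have bE : (fun j => s * (j == i)%:R + (1 - s) * w j) = bary x.
  apply: bary_unique => //; rewrite big_split /= -!mulr_sumr w1.
  have := sumD (fun=> 1); under eq_bigr do rewrite mulr1; move=> ->.
  by rewrite !mulr1 addrC subrK.
split.
  by apply/hull_baryP => j; rewrite -bE addr_ge0// mulr_ge0// ltW.
by rewrite -bE eqxx mulr1 lerDl mulr_ge0// ltW.
Qed.

End Barycentric.

Section CellMeasure.
Variable R : realType.

Lemma integral_onemX n :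
  (\int[@lebesgue_measure R]_(s in `[0%R, 1%R]) ((1 - s) ^+ n)%:E = (n.+1%:R^-1)%:E)%E.
Proof.
have := @integrable_XMonemX R 0 n.
rewrite (_ : EFin \o _ = fun s => ((1 - s) ^+ n)%:E); last first.
  by apply/funext => s /=; rewrite XMonemX0n.
move=> /integrable_fin_num h.
rewrite -[LHS]fineK; last by apply: h.
by rewrite -Rintegral_onemXn.
Qed.

Lemma section_fubini n (mu : {sigma_finite_measure set (mrV R n) -> \bar R})
    (S : set (measurableTypeR R * mrV R n)) : measurable S ->
  (\int[@lebesgue_measure R]_t mu (xsection S t) =
   \int[mu]_a lebesgue_measure (ysection S a))%E.
Proof.
move=> mS; have := indic_fubini_tonelli (@lebesgue_measure R) mu mS.
by rewrite indic_fubini_tonelli_FE// indic_fubini_tonelli_GE.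
Qed.

Lemma lebesgue_measure_scaled_itv (q a b : R) : q != 0 -> a <= b ->
  lebesgue_measure [set t : R | a <= t / q <= b] = (`|q| * (b - a))%:E.
Proof.
move=> q0 ab; have [qn|qp|/eqP] := ltgtP q 0; last by rewrite (negbTE q0).
  rewrite (_ : [set t | _] = `[b * q, a * q]%classic); last first.
    by apply/seteqP; split=> t /=; rewrite in_itv /= ler_ndivlMr// ler_ndivrMr// andbC.
  rewrite lebesgue_measure_itv /= lte_fin ltr_nM2r//.
  case: ltP => h; first by rewrite -EFinD ltr0_norm//; congr EFin; ring.
  by rewrite (_ : a = b) ?subrr ?mulr0//; apply/eqP; rewrite eq_le ab h.
rewrite (_ : [set t | _] = `[a * q, b * q]%classic); last first.
  by apply/seteqP; split=> t /=; rewrite in_itv /= ler_pdivlMr// ler_pdivrMr.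
rewrite lebesgue_measure_itv /= lte_fin ltr_pM2r//.
case: ltP => h; first by rewrite -EFinD gtr0_norm//; congr EFin; ring.
by rewrite (_ : a = b) ?subrr ?mulr0//; apply/eqP; rewrite eq_le ab h.
Qed.

Section Cell.
Variables (n : nat) (A : 'I_n.+1 -> 'rV[R]_n).
Hypothesis aA : aff_indep A.

Lemma measurable_moment z :
  measurable_fun setT ((fun x => moment (bary A x) z) : mrV R n -> R).
Proof.
rewrite /moment; apply: measurable_sum => k; apply: measurable_funM => //.
exact: measurable_bary.
Qed.

Lemma hull_prism_cell_bary z q x t : q != 0 ->
  hull (prism_cell A z q) (ext x t) <->
  hull A x /\ moment (bary A x) z <= t / q <= moment (bary A x) (z + 1).
Proof.
move=> q0; split.
  move=> /hull_prism_cellP -/(_ q0) [L [LL xL hz]]; split.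
    by apply/hullP; exists L.
  by rewrite -(bary_unique aA LL.2 xL).
move=> [/hull_baryP b0 hz]; apply/hull_prism_cellP => //.
exists (bary A x); split=> //; first by split; [exact: b0|exact: (baryP aA x).1].
by rewrite (baryP aA x).2.
Qed.

Lemma meas_prism_cell z q : q != 0 ->
  meas (hull (prism_cell A z q)) = (`|q|%:E * meas (hull A))%E.
Proof.
move=> q0; have [mu muE] := meas_sigma_finite R n.
pose i := res n z.
pose S1 : set (measurableTypeR R * mrV R n) :=
  [set y | hull (prism_cell A z q) (ext y.2 y.1)].
pose S2 : set (measurableTypeR R * mrV R n) :=
  [set y | hull A y.2 /\ 0 <= y.1 <= bary A y.2 i].
have mhull : measurable [set y : measurableTypeR R * mrV R n | hull A y.2].
  have := @measurable_snd _ _ (measurableTypeR R) (mrV R n) measurableT _ (measurable_hull aA).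
  by rewrite setTI.
have mle (f g : measurableTypeR R * mrV R n -> R) : measurable_fun setT f ->
    measurable_fun setT g -> measurable [set y | f y <= g y].
  by move=> mf mg; rewrite -[X in measurable X]setTI; exact: measurable_fun_le.
have mfst : measurable_fun setT (fst : measurableTypeR R * mrV R n -> measurableTypeR R).
  exact: measurable_fst.
have msnd (f : mrV R n -> R) : measurable_fun setT f ->
    measurable_fun setT (fun y : measurableTypeR R * mrV R n => f y.2).
  by move=> mf; apply: (measurableT_comp mf); exact: measurable_snd.
have mS1 : measurable S1.
  rewrite (_ : S1 = [set y | hull A y.2] `&`
    ([set y | moment (bary A y.2) z <= y.1 / q] `&`
     [set y | y.1 / q <= moment (bary A y.2) (z + 1)])); last first.
    apply/seteqP; split=> y.
      by move=> /hull_prism_cell_bary -/(_ q0)[h /andP[]].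
    by move=> [h [h1 h2]]; apply/hull_prism_cell_bary => //; split=> //; apply/andP.
  have mq : measurable_fun setT (fun y : measurableTypeR R * mrV R n => y.1 / q).
    by apply: measurable_funM.
  have mm z' := msnd _ (measurable_moment z').
  by apply: measurableI => //; apply: measurableI; apply: mle.
have mS2 : measurable S2.
  rewrite (_ : S2 = [set y | hull A y.2] `&`
    ([set y | 0 <= y.1] `&` [set y | y.1 <= bary A y.2 i])); last first.
    apply/seteqP; split=> y; first by move=> [h /andP[]].
    by move=> [h [h1 h2]]; split=> //; apply/andP.
  apply: measurableI => //; apply: measurableI; apply: mle => //.
  by apply: (msnd (bary A ^~ i)); exact: measurable_bary.
have S12 a : lebesgue_measure (ysection S1 a) =
    ((`|q| * n.+1%:R)%:E * lebesgue_measure (ysection S2 a))%E.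
  have [ha|ha] := pselect (hull A a); last first.
    rewrite (_ : ysection S1 a = set0); last first.
      apply/seteqP; split=> // t; rewrite /ysection /= inE.
      by move=> /hull_prism_cell_bary -/(_ q0)[].
    rewrite (_ : ysection S2 a = set0) ?measure0 ?mule0//.
    by apply/seteqP; split=> // t; rewrite /ysection /= inE => -[].
  have bi : 0 <= bary A a i by move: ha => /hull_baryP -/(_ aA); exact.
  rewrite (_ : ysection S1 a = [set t : R | moment (bary A a) z <= t / q <=
      moment (bary A a) (z + 1)]); last first.
    apply/seteqP; split=> t; rewrite /ysection /= inE.
      by move=> /hull_prism_cell_bary -/(_ q0)[].
    by move=> h; apply/hull_prism_cell_bary.
  rewrite (_ : ysection S2 a = [set t : R | 0 <= t / 1 <= bary A a i]); last first.
    apply/seteqP; split=> t; rewrite /ysection /= inE divr1; first by case.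
    by split.
  rewrite !lebesgue_measure_scaled_itv ?oner_eq0//; last first.
    by rewrite momentS lerDl mulr_ge0.
  by rewrite -EFinM momentS normr1; congr EFin; rewrite /i; ring.
have S2E s : 0 <= s < 1 -> mu (xsection S2 s) = (((1 - s) ^+ n)%:E * mu (hull A))%E.
  move=> /andP[s0 s1]; rewrite muE -(@meas_homothety _ _ (s *: A i)).
  - rewrite -bary_ge_homothety ?s0//; congr meas.
    apply/seteqP; split=> a; rewrite /xsection /= inE.
      by move=> [h /andP[]].
    by move=> [h1 h2]; split=> //; rewrite s0.
  - by rewrite subr_gt0.
  - exact: measurable_hull.
have S2out s : ~~ (0 <= s <= 1) -> mu (xsection S2 s) = 0%E.
  move=> hs; rewrite (_ : xsection S2 s = set0) ?measure0//.
  apply/seteqP; split=> // a; rewrite /xsection /= inE => -[/= ha /andP[h1 h2]].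
  move: hs; rewrite h1 /= => /negP; apply; apply: (le_trans h2).
  rewrite -(baryP aA a).1 (bigD1 i)//= lerDl; apply: sumr_ge0 => j _.
  by move: ha => /hull_baryP -/(_ aA); exact.
have mS2x : measurable_fun setT (fun s : measurableTypeR R => mu (xsection S2 s)).
  exact: (measurable_fun_xsection mu mS2).
transitivity (\int[@lebesgue_measure R]_t mu (xsection S1 t))%E.
  rewrite /= muE; apply: eq_integral => t _; congr meas.
  by apply/seteqP; split=> a; rewrite /xsection /= inE.
rewrite section_fubini//.
under eq_integral do rewrite S12.
have mS2y : measurable_fun setT (fun a : mrV R n => lebesgue_measure (ysection S2 a)).
  exact: (measurable_fun_ysection (@lebesgue_measure R) mS2).
rewrite (ge0_integralZl mu measurableT mS2y) ?lee_fin ?mulr_ge0//.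
rewrite -section_fubini//.
have -> : (\int[@lebesgue_measure R]_t mu (xsection S2 t) =
    \int[@lebesgue_measure R]_(t in `[0%R, 1%R]) mu (xsection S2 t))%E.
  rewrite [RHS]integral_mkcond; apply: eq_integral => s _; rewrite patchE.
  case: ifPn => //; rewrite notin_setE /= in_itv /= => /negP; exact: S2out.
rewrite -integral_itv_bndo_bndc; last exact: measurable_funTS mS2x.
under eq_integral => s.
  rewrite inE /= in_itv /= => hs; rewrite S2E//; over.
have mX : measurable_fun setT (fun s : R => ((1 - s) ^+ n)%:E).
  by apply/measurable_EFinP; apply: measurable_funX; exact: measurable_funB.
rewrite integral_itv_bndo_bndc; last first.
  by apply: emeasurable_funM => //; exact: measurable_funTS mX.
rewrite ge0_integralZr//; last 2 first.
- exact: measurable_funTS mX.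
- by move=> s /=; rewrite in_itv /= => /andP[_ s1]; rewrite lee_fin exprn_ge0// subr_ge0.
by rewrite integral_onemX muleA -EFinM mulfK ?pnatr_eq0// muE.
Qed.

End Cell.
End CellMeasure.

Section Mesh.
Variable R : realType.

Definition prism_mesh n (T : set ('I_n.+1 -> 'rV[R]_n)) (q : R) :
    set ('I_n.+2 -> 'rV[R]_n.+1) :=
  [set L | exists A z, T A /\ L = prism_cell A z q].

Definition relabelling n (T : set ('I_n.+1 -> 'rV[R]_n)) (c : 'rV[R]_n -> 'I_n.+1) :
    set ('I_n.+1 -> 'rV[R]_n) :=
  [set A | (exists2 K, T K & exists s : 'S_n.+1, A = K \o s) /\ forall i, c (A i) = i].

Definition uniform_mesh n (T : set ('I_n.+1 -> 'rV[R]_n)) (v : R) : Prop :=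
  [/\ forall V, T V -> aff_indep V,
      forall x, exists2 V, T V & hull V x,
      forall V W, T V -> T W -> compatible V W
    & forall V, T V -> meas (hull V) = v%:E].

Lemma relabelling_uniform n (T : set ('I_n.+1 -> 'rV[R]_n)) c v :
  (forall K, T K -> injective (c \o K)) -> uniform_mesh T v ->
  uniform_mesh (relabelling T c) v.
Proof.
move=> cT [aT coverT compT measT]; split.
- by move=> _ [[K TK [s ->]] _]; exact/aff_indep_perm/aT.
- move=> x; have [K TK Kx] := coverT x.
  pose s : 'S_n.+1 := ((perm (cT K TK))^-1)%g.
  exists (K \o s); last by rewrite hull_perm.
  split; first by exists K => //; exists s.
  by move=> i; rewrite -[RHS](permKV (perm (cT K TK))) permE.
- by move=> _ _ [[K TK [s ->]] _] [[L TL [t ->]] _]; exact/compatible_perm/compT.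
- by move=> _ [[K TK [s ->]] _]; rewrite hull_perm measT.
Qed.

Lemma prism_mesh_uniform n (T : set ('I_n.+1 -> 'rV[R]_n)) c v q : q != 0 ->
  (forall A, T A -> forall i, c (A i) = i) -> uniform_mesh T v ->
  uniform_mesh (prism_mesh T q) (v * `|q|).
Proof.
move=> q0 cT [aT coverT compT measT]; split.
- by move=> _ [A [z [TA ->]]]; exact/aff_indep_prism_cell/aT.
- move=> x; have [A TA Ax] := coverT (rowproj x).
  have [z hz] := prism_cell_cover (x 0 ord_max) q0 Ax.
  by exists (prism_cell A z q); [exists A, z | rewrite -(ext_rowproj x)].
- move=> _ _ [A [z [TA ->]]] [B [z' [TB ->]]].
  by apply: (compatible_prism_cell q0 (compT _ _ TA TB) (compT _ _ TB TA) (cT _ TA) (cT _ TB)).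
- move=> _ [A [z [TA ->]]].
  by rewrite (meas_prism_cell (aT _ TA))// measT// -EFinM mulrC.
Qed.

Lemma point_mesh_uniform : uniform_mesh [set fun _ : 'I_1 => (0 : 'rV[R]_0)] 1.
Proof.
have w1 (w : 'I_1 -> R) i : \sum_j w j = w i by rewrite big_ord1 (ord1 i).
split.
- by move=> _ -> w w0 _ i; rewrite -(w1 w) w0.
- move=> x; exists (fun=> 0) => //; apply/hullP; exists (fun=> 1).
    by split=> // ; rewrite big_ord1.
  by apply/rowP; case.
- move=> _ _ -> -> v w [_ v1] [_ u1] _ i _; exists i => //.
  by rewrite -(w1 w) -(w1 v) v1 u1.
- move=> _ ->; rewrite /=; case: asboolP => // h; exfalso; apply: h.
  apply/hullP; exists (fun=> 1); first by split=> //; rewrite big_ord1.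
  by apply/rowP; case.
Qed.

Lemma uniform_mesh_tessellation n (T : set ('I_n.+1 -> 'rV[R]_n)) v :
  uniform_mesh T v -> simplicial_tessellation T.
Proof.
move=> [aT coverT compT _]; split=> //.
  apply/seteqP; split=> // x _.
  by have [V TV Vx] := coverT x; exists V.
move=> V W TV TW VW; apply/seteqP; split=> // x [Vx Wx]; apply: VW.
apply/seteqP; split; first exact: (interior_sub_hull _ (compT V W TV TW) Vx Wx).
exact: (interior_sub_hull _ (compT W V TW TV) Wx Vx).
Qed.

Section Construction.
Variables (p : nat -> R) (pi : forall m : nat, 'S_m).

Lemma T1E : T1 p = prism_mesh [set fun _ : 'I_1 => (0 : 'rV[R]_0)] (p 1%N).
Proof.
have E z : (fun k : 'I_2 => \row_(i < 1) ((z + (k : nat)%:Z)%:~R * p 1)) =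
    prism_cell (fun _ : 'I_1 => (0 : 'rV[R]_0)) z (p 1).
  apply/funext => k; apply/rowP => i; rewrite (_ : i = ord_max); last first.
    by apply/val_inj; rewrite (ord1 i).
  by rewrite /prism_cell ext_max mxE.
apply/seteqP; split=> V.
  by move=> [z ->]; exists (fun=> 0), z; rewrite E.
by move=> [_ [z [-> ->]]]; exists z; rewrite E.
Qed.

Lemma TstepE n (T : set ('I_n.+2 -> 'rV[R]_n.+1)) :
  Tstep p pi T =
  prism_mesh (relabelling T (fun x => pi n.+2 (color p x))) (p n.+2).
Proof.
apply/seteqP; split=> L.
  move=> [K [z [s [TK cK ->]]]]; exists (K \o s), z; split=> //.
  by split=> //; exists K => //; exists s.
move=> [_ [z [[[K TK [s ->]] cK] ->]]].
by exists K, z, s.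
Qed.

Lemma color_prism_cell n (A : 'I_n.+1 -> 'rV[R]_n) z k : p n.+1 != 0 ->
  color p (prism_cell A z (p n.+1) k) = res n.+1 (z + (k : nat)%:Z).
Proof. by move=> p0; rewrite /color /prism_cell ext_max mulfK// intrKfloor. Qed.

Lemma color_prism_mesh_inj n (T : set ('I_n.+1 -> 'rV[R]_n)) K : p n.+1 != 0 ->
  prism_mesh T (p n.+1) K -> injective (@color R p n \o K).
Proof.
move=> p0 [A [z [_ ->]]] k l /=; rewrite !color_prism_cell//.
exact: res_shift_inj.
Qed.

Lemma Tcon_prism n : exists T, @Tcon R p pi n = prism_mesh T (p n.+1).
Proof. by case: n => [|n] /=; [rewrite T1E|rewrite TstepE]; eexists. Qed.

Lemma Tcon_uniform n : (forall i : nat, (0 < i <= n.+1)%N -> p i != 0) ->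
  uniform_mesh (@Tcon R p pi n) (\prod_(1 <= i < n.+2) `|p i|).
Proof.
elim: n => [|n IH] hp /=.
  rewrite T1E big_nat1 -[`|p 1|]mul1r.
  apply: (@prism_mesh_uniform _ _ (fun=> ord0)); [exact: hp| |exact: point_mesh_uniform].
  by move=> A _ i; rewrite (ord1 i).
rewrite TstepE big_nat_recr//=.
apply: (@prism_mesh_uniform _ _ (fun x => pi n.+2 (color p x)));
  [by apply: hp; rewrite leqnn|by move=> A []|].
apply: relabelling_uniform.
  have [T ->] := Tcon_prism n => K TK.
  apply: (inj_comp (@perm_inj _ _)); apply: color_prism_mesh_inj TK.
  by apply: hp; rewrite /= leqnSn.
by apply: IH => i /andP[i0 i1]; apply: hp; rewrite i0 ltnW.
Qed.

End Construction.
End Mesh.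

(* d = n.+1 >= 1;  @Tcon R p pi n  is  T_d(p, pi). *)
Theorem theorem2 (R : realType) (n : nat) (p : nat -> R)
  (pi : forall m : nat, 'S_m)
  (hp : forall i : nat, (0 < i <= n.+1)%N -> p i != 0) :
  [/\ simplicial_tessellation (@Tcon R p pi n),
      (forall K, @Tcon R p pi n K ->
         meas (hull K) = (\prod_(1 <= i < n.+2) `|p i|)%:E)
    & forall F : set ('I_n.+2 -> 'rV[R]_n.+1),
        F `<=` @Tcon R p pi n -> finite_set F ->
        connected (\bigcup_(K in F) hull K) ->
        face_to_face F].
Proof.
have U := Tcon_uniform pi hp; have [_ _ compT measT] := U; split.
- exact: uniform_mesh_tessellation U.
- exact: measT.
- move=> F FT _ _ V W /FT TV /FT TW; right.
  by apply: compatible_face; exact: compT.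
Qed.
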